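(* For $n\geqslant 1$ let $A_n(x,p,q)=\sum_{\pi\in\mathcal{S}_n}x^{\mathrm{exc}(\pi)}p^{\mathrm{fix}(\pi)}q^{\mathrm{cyc}(\pi)}$. Let $p\in[0,1]$ and $q\in[0,1]$ be given real numbers. Then: (i) For $n\geqslant 1$, the polynomial $A_n(x,1,q)$ (in $x$) is bi-$\gamma$-positive with respect to degree $n-1$, i.e. there are nonnegative reals $\xi_k,\eta_k$ (depending on $n,q$) with $$A_n(x,1,q)=\sum_{k=0}^{\lfloor (n-1)/2\rfloor}\xi_k x^k(1+x)^{n-1-2k}+x\sum_{k=0}^{\lfloor (n-2)/2\rfloor}\eta_k x^k(1+x)^{n-2-2k}.$$ (ii) For $n\geqslant 1$, the polynomial $A_n(x,p,q)$ (in $x$) is alternatingly increasing: writing $A_n(x,p,q)=\sum_{\ell=0}^{n-1}f_\ell x^\ell$, one has $f_0\leqslant f_{n-1}\leqslant f_1\leqslant f_{n-2}\leqslant\cdots\leqslant f_{\lfloor n/2\rfloor}$.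
   Context: $\mathcal{S}_n$ is the symmetric group on $[n]=\{1,\dots,n\}$. For $\pi\in\mathcal{S}_n$: $\mathrm{exc}(\pi)=\#\{i:\pi(i)>i\}$ (excedances), $\mathrm{fix}(\pi)=\#\{i:\pi(i)=i\}$ (fixed points), $\mathrm{cyc}(\pi)$ is the number of cycles of $\pi$. Bi-$\gamma$-positivity means both polynomials of the symmetric decomposition $f=a+xb$ (with $a(x)=\frac{f(x)-x^{d+1}f(1/x)}{1-x}$, $b(x)=\frac{x^df(1/x)-f(x)}{1-x}$, $d$ the degree) have nonnegative $\gamma$-coefficients, which is the displayed expansion. *)

(* Defs.v *)
From HB Require Import structures.
From mathcomp Require Import all_boot all_order all_algebra all_fingroup.
From mathcomp Require Import reals.

Set Implicit Arguments.
Unset Strict Implicit.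
Unset Printing Implicit Defensive.

Import Order.TTheory GRing.Theory Num.Theory.
Local Open Scope ring_scope.

(* [n] is represented by 'I_n = {0, ..., n-1}; the shift by one affects none
   of the three statistics. *)
Definition exc (n : nat) (s : 'S_n) : nat := #|[set i : 'I_n | (i < s i)%N]|.

Definition fix_pts (n : nat) (s : 'S_n) : nat := #|[set i : 'I_n | s i == i]|.

(* [porbits s] is the set of all cycles of [s], fixed points included. *)
Definition cyc (n : nat) (s : 'S_n) : nat := #|porbits s|.

(* A_n(x, p, q) as a polynomial in x = 'X. *)
Definition Apoly (R : realType) (n : nat) (p q : R) : {poly R} :=
  \sum_(s : 'S_n) (p ^+ fix_pts s * q ^+ cyc s) *: 'X^(exc s).

(* x^d f(1/x), for deg f <= d. *)
Definition reciprocal (R : realType) (d : nat) (f : {poly R}) : {poly R} :=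
  \poly_(i < d.+1) f`_(d - i).

(* The symmetric decomposition f = a + x b with respect to degree d. When
   deg f <= d both numerators vanish at 1, so that both divisions by 1 - x
   are exact. *)
Definition symdec_a (R : realType) (d : nat) (f : {poly R}) : {poly R} :=
  (f - 'X * reciprocal d f) %/ (1 - 'X).

Definition symdec_b (R : realType) (d : nat) (f : {poly R}) : {poly R} :=
  (reciprocal d f - f) %/ (1 - 'X).

(* sum_{k=0}^{floor((m-1)/2)} c_k x^k (1+x)^(m-1-2k): the expansion in the
   gamma-basis of center (m-1)/2. It is indexed by m = degree + 1, and the
   number of terms is uphalf m = floor((m-1)/2) + 1; for m = 0 (degree -1)
   the sum is empty. *)
Definition gamma_sum (R : realType) (m : nat) (c : nat -> R) : {poly R} :=
  \sum_(0 <= k < uphalf m) c k *: ('X^k * (1 + 'X) ^+ (m - 1 - 2 * k)).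

Definition gamma_positive (R : realType) (m : nat) (f : {poly R}) : Prop :=
  exists c : nat -> R, (forall k, 0 <= c k) /\ f = gamma_sum m c.

(* With respect to degree d: a has nonnegative gamma-coefficients for degree d,
   b for degree d - 1. *)
Definition bi_gamma_positive (R : realType) (d : nat) (f : {poly R}) : Prop :=
  [/\ (size f <= d.+1)%N,
      gamma_positive d.+1 (symdec_a d f)
    & gamma_positive d (symdec_b d f)].

(* The j-th index, 0 <= j <= d, in the list 0, d, 1, d-1, 2, ..., which ends
   with floor((d+1)/2). *)
Definition alt_index (d j : nat) : nat := if odd j then (d - j./2)%N else j./2.

(* With respect to degree d: f = sum_{l <= d} f_l x^l and
   f_0 <= f_d <= f_1 <= f_{d-1} <= ... <= f_{floor((d+1)/2)}. *)
Definition alternatingly_increasing (R : realType) (d : nat) (f : {poly R}) :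
    Prop :=
  (size f <= d.+1)%N /\
  forall j, (j < d)%N -> f`_(alt_index d j) <= f`_(alt_index d j.+1).

(* Main.v *)
Require Import Defs.
From HB Require Import structures.
From mathcomp Require Import all_boot all_order all_algebra all_fingroup.
From mathcomp Require Import reals.
From mathcomp Require Import zify ring.
Set Implicit Arguments.
Unset Strict Implicit.
Unset Printing Implicit Defensive.
Import Order.TTheory GRing.Theory Num.Theory.
Local Open Scope ring_scope.

(* Inserting the largest letter into a cycle gives, for A_n homogenized by a
   variable y marking the non-fixed non-excedances, A_{n+1} = p q A_n + D A_n
   with the derivation D x = D y = D p = x y. It maps u = x + y to 2 v and
   v = x y to u v, so it preserves nonnegativity in the gamma basis
   v^k u^(n-2k).
   (i) For p = y, write A_n = y a + v b. Since y^2 = y u - v, one step gives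
   a' = q u a + D a + q v b and b' = (1 - q) a + u b + D b, which are
   nonnegative in the gamma basis when 0 <= q <= 1.
   (ii) A_n(x, p, q) = sum_k C(n, k) (p q)^k d_{n-k}(x, q), where d_m
   enumerates derangements and is gamma-positive, hence symmetric unimodal,
   with center m / 2. Half of the required inequalities hold for each summand.
   In the other half the summands with k > 0 contribute the wrong sign, but
   their size is largest at p = 1, where (i) applies. *)

(** * Cycles after adjoining a fixed point *)

Lemma lift_permX n (i : 'I_n.+1) (s : 'S_n) k :
  (lift_perm i i s ^+ k)%g = lift_perm i i (s ^+ k)%g.
Proof.
by elim: k => [|k IHk]; rewrite ?expg0 ?lift_perm1 // !expgS IHk lift_permM.
Qed.

Lemma porbit_lift_perm_lift n (i : 'I_n.+1) (s : 'S_n) k :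
  porbit (lift_perm i i s) (lift i k) = lift i @: porbit s k.
Proof.
apply/setP => x; apply/porbitP/imsetP => [[m ->]|[y /porbitP[m ->] ->]].
  exists ((s ^+ m)%g k); first by apply/porbitP; exists m.
  by rewrite lift_permX lift_perm_lift.
by exists m; rewrite lift_permX lift_perm_lift.
Qed.

Lemma porbit_lift_perm_id n (i : 'I_n.+1) (s : 'S_n) :
  porbit (lift_perm i i s) i = [set i].
Proof.
apply/setP => x; rewrite inE; apply/porbitP/eqP => [[m ->]|->].
  by rewrite lift_permX lift_perm_id.
by exists 0%N; rewrite expg0 perm1.
Qed.

(** The cycles of the lift are the images of the cycles of [s] under [lift i], together with the
    singleton [[set i]], which is none of those images because [lift i] avoids [i]. *)
Lemma cyc_lift_perm n (i : 'I_n.+1) (s : 'S_n) :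
  cyc (lift_perm i i s) = (cyc s).+1.
Proof.
have -> : cyc s = #|[set lift i @: A | A : {set 'I_n} in porbits s]|.
  by rewrite card_imset //; apply: imset_inj lift_inj.
rewrite /cyc; set P := [set _ | _ in porbits s].
suff -> : porbits (lift_perm i i s) = [set i] |: P.
  rewrite cardsU1 [_ \notin _](_ : _ = true) //.
  apply/imsetP => -[A _ /setP/(_ i)]; rewrite set11 => /esym/imsetP[k _ ik].
  by have := neq_lift i k; rewrite -ik eqxx.
apply/setP => B; rewrite in_setU1; apply/imsetP/predU1P.
  case=> x _ ->; case: (unliftP i x) => [k ->|->].
    right; rewrite porbit_lift_perm_lift.
    by apply/imset_f/imset_f.
  by left; rewrite porbit_lift_perm_id.
case=> [->|/imsetP[A /imsetP[k _ ->] ->]].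
  by exists i; rewrite ?porbit_lift_perm_id.
by exists (lift i k); rewrite ?porbit_lift_perm_lift.
Qed.

(** * Insertion of the largest letter into a permutation *)

(** Products of permutations act from left to right, so the arc from [j] to [s j] becomes a path
    through [ord_max]; for [j = ord_max] the new letter is a fixed point. *)
Definition insert_max n (j : 'I_n.+1) (s : 'S_n) : 'S_n.+1 :=
  (tperm j ord_max * lift_perm ord_max ord_max s)%g.

Lemma insert_max_to n (j : 'I_n.+1) (s : 'S_n) : insert_max j s j = ord_max.
Proof. by rewrite permM tpermL lift_perm_id. Qed.

(** The position [j] is recovered as the preimage of [ord_max], which gives injectivity; the
    cardinalities agree since (n+1)! = (n+1) n!. *)
Lemma insert_max_bij n :
  bijective (fun u : 'S_n * 'I_n.+1 => insert_max u.2 u.1).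
Proof.
apply: inj_card_bij => [[s j] [s' j'] /= eq_t|].
  have jj' : j = j'.
    by apply: (@perm_inj _ (insert_max j s)); rewrite {2}eq_t !insert_max_to.
  congr (_, _) => //; move: eq_t; rewrite jj' => /mulgI eq_s.
  apply/permP => k; apply: (@lift_inj _ ord_max).
  by rewrite -!(lift_perm_lift ord_max ord_max) eq_s.
by rewrite card_prod !card_Sn card_ord factS mulnC.
Qed.

Lemma big_insert_max (R : nmodType) n (F : 'S_n.+1 -> R) :
  \sum_t F t =
  \sum_s (F (insert_max ord_max s)
          + \sum_(i < n) F (insert_max (lift ord_max i) s)).
Proof.
rewrite (reindex _ (onW_bij _ (insert_max_bij n))) /=.
rewrite -(pair_bigA _ (fun s j => F (insert_max j s))) /=.
apply: eq_bigr => s _; rewrite big_ord_recr addrC /=.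
congr (_ + _); apply: eq_bigr => i _; congr (F (insert_max _ s)).
by apply/val_inj; rewrite /= /bump leqNgt ltn_ord.
Qed.

Lemma excE n (s : 'S_n) : exc s = (\sum_(i < n) (i < s i))%N.
Proof. by rewrite /exc -sum1dep_card big_mkcond. Qed.

Lemma fix_ptsE n (s : 'S_n) : fix_pts s = (\sum_(i < n) (s i == i))%N.
Proof. by rewrite /fix_pts -sum1dep_card big_mkcond. Qed.

Lemma sum_lift_max n (G : 'I_n.+1 -> nat) :
  (\sum_i G i = \sum_(i < n) G (lift ord_max i) + G ord_max)%N.
Proof.
rewrite big_ord_recr; congr (_ + _)%N; apply: eq_bigr => i _; congr G.
by apply/val_inj; rewrite /= /bump leqNgt ltn_ord.
Qed.

Section Insertion.
Variables (n : nat) (s : 'S_n).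
Implicit Types i j : 'I_n.

Lemma insert_max_ord_max :
  insert_max ord_max s = lift_perm ord_max ord_max s.
Proof. by rewrite /insert_max tperm1 mul1g. Qed.

Lemma insert_max_lift i j :
  insert_max (lift ord_max j) s (lift ord_max i) =
  if i == j then ord_max else lift ord_max (s i).
Proof.
rewrite permM; case: eqP => [->|/eqP i_ne_j].
  by rewrite tpermL lift_perm_id.
by rewrite tpermD ?lift_perm_lift ?neq_lift // (inj_eq lift_inj) eq_sym.
Qed.

Lemma insert_max_max j :
  insert_max (lift ord_max j) s ord_max = lift ord_max (s j).
Proof. by rewrite permM tpermR lift_perm_lift. Qed.

Lemma cyc_insert_fix : cyc (insert_max ord_max s) = (cyc s).+1.
Proof. by rewrite insert_max_ord_max cyc_lift_perm. Qed.

(** Lifting creates one extra cycle, and the transposition, whose two points lie in different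
    cycles, merges it with another one. *)
Lemma cyc_insert j : cyc (insert_max (lift ord_max j) s) = cyc s.
Proof.
have := porbits_mul_tperm (lift_perm ord_max ord_max s) (lift ord_max j) ord_max.
rewrite /= porbit_lift_perm_id inE eq_sym neq_lift /= -!/(cyc _) cyc_lift_perm.
rewrite /insert_max; lia.
Qed.

Lemma exc_insert_fix : exc (insert_max ord_max s) = exc s.
Proof.
rewrite insert_max_ord_max !excE sum_lift_max lift_perm_id ltnn addn0.
by apply: eq_bigr => i _; rewrite lift_perm_lift !lift_max.
Qed.

Lemma fix_insert_fix : fix_pts (insert_max ord_max s) = (fix_pts s).+1.
Proof.
rewrite insert_max_ord_max !fix_ptsE sum_lift_max lift_perm_id eqxx addn1.
by congr _.+1; apply: eq_bigr => i _; rewrite lift_perm_lift (inj_eq lift_inj).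
Qed.

(** The arc out of [j] is replaced by an arc into [ord_max], always an excedance, and one out of
    [ord_max], never an excedance. The additive form avoids truncated subtraction. *)
Lemma exc_insert j :
  (exc (insert_max (lift ord_max j) s) + (j < s j) = (exc s).+1)%N.
Proof.
rewrite !excE sum_lift_max insert_max_max. 
have -> : (@ord_max n < lift ord_max (s j))%N = false by rewrite ltnNge leq_ord.
rewrite addn0 (bigD1 j) // [in RHS](bigD1 j) // insert_max_lift eqxx lift_max.
rewrite ltn_ord -addnA addnCA add1n [RHS]/= addnC; congr (_ + _).+1.
by apply: eq_bigr => i /negPf ij; rewrite insert_max_lift ij !lift_max.
Qed.

Lemma fix_insert j :
  (fix_pts (insert_max (lift ord_max j) s) + (s j == j) = fix_pts s)%N.
Proof.
rewrite !fix_ptsE sum_lift_max insert_max_max eq_sym (negPf (neq_lift _ _)) addn0.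
rewrite (bigD1 j) // [in RHS](bigD1 j) // insert_max_lift eqxx (negPf (neq_lift _ _)).
rewrite addnC; congr (_ + _)%N.
by apply: eq_bigr => i /negPf ij; rewrite insert_max_lift ij (inj_eq lift_inj).
Qed.

End Insertion.

(** * The gamma cone and the derivation acting on it *)

Section Cones.
Variable R : realType.
Implicit Types (f g : {poly R}) (c : nat -> R) (m k : nat).

Definition gamma_elt m k : {poly R} := 'X^k * (1 + 'X) ^+ (m - 1 - 2 * k).

Lemma gamma_positive_ind m (P : {poly R} -> Prop) f :
  P 0 -> (forall g h, P g -> P h -> P (g + h)) ->
  (forall a k, 0 <= a -> (2 * k < m)%N -> P (a *: gamma_elt m k)) ->
  gamma_positive m f -> P f.
Proof.
move=> P0 PD PZ [c [c_ge0 ->]]; rewrite /gamma_sum big_nat_cond.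
by apply: big_ind => // k; rewrite andbT => k_lt; apply: PZ => //; lia.
Qed.

Lemma gamma_positive0 m : gamma_positive m (0 : {poly R}).
Proof.
exists (fun=> 0); split=> //.
by rewrite /gamma_sum big1 // => k _; rewrite scale0r.
Qed.

Lemma gamma_positiveD m f g :
  gamma_positive m f -> gamma_positive m g -> gamma_positive m (f + g).
Proof.
move=> [c [c_ge0 ->]] [c' [c'_ge0 ->]]; exists (fun k => c k + c' k).
split=> [k|]; first exact: addr_ge0.
by rewrite /gamma_sum -big_split /=; apply: eq_bigr => k _; rewrite scalerDl.
Qed.

Lemma gamma_positiveZ m a f :
  0 <= a -> gamma_positive m f -> gamma_positive m (a *: f).
Proof.
move=> a_ge0 [c [c_ge0 ->]]; exists (fun k => a * c k).
split=> [k|]; first exact: mulr_ge0.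
by rewrite /gamma_sum scaler_sumr; apply: eq_bigr => k _; rewrite scalerA.
Qed.

Lemma gamma_positive_elt m k : (2 * k < m)%N -> gamma_positive m (gamma_elt m k).
Proof.
move=> k_lt; exists (fun i => (i == k)%:R); split=> [i|]; first exact: ler0n.
rewrite /gamma_sum (bigD1_seq k) /= ?iota_uniq //; last first.
  by rewrite mem_index_iota; lia.
rewrite eqxx scale1r big1 ?addr0 // => i /negPf ->; exact: scale0r.
Qed.

Lemma gamma_positive_size0 f : gamma_positive 0 f -> f = 0.
Proof. by case=> c [_ ->]; rewrite /gamma_sum big_geq. Qed.

Lemma gamma_positive_mul1X m f :
  gamma_positive m f -> gamma_positive m.+1 ((1 + 'X) * f).
Proof.
apply: (gamma_positive_ind (P := fun g => gamma_positive m.+1 ((1 + 'X) * g)))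
  => [|g h gP hP|a k a_ge0 k_lt].
- by rewrite mulr0; apply: gamma_positive0.
- by rewrite mulrDr; apply: gamma_positiveD.
have -> : (1 + 'X) * (a *: gamma_elt m k) = a *: gamma_elt m.+1 k.
  rewrite -scalerAr /gamma_elt (_ : m.+1 - 1 - _ = (m - 1 - 2 * k).+1)%N; last by lia.
  by rewrite exprS; congr (_ *: _); ring.
by apply: gamma_positiveZ => //; apply: gamma_positive_elt; lia.
Qed.

Lemma gamma_positive_mulX m f :
  gamma_positive m f -> gamma_positive m.+2 ('X * f).
Proof.
apply: (gamma_positive_ind (P := fun g => gamma_positive m.+2 ('X * g)))
  => [|g h gP hP|a k a_ge0 k_lt].
- by rewrite mulr0; apply: gamma_positive0.
- by rewrite mulrDr; apply: gamma_positiveD.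
have -> : 'X * (a *: gamma_elt m k) = a *: gamma_elt m.+2 k.+1.
  rewrite -scalerAr /gamma_elt (_ : m.+2 - 1 - _ = (m - 1 - 2 * k))%N; last by lia.
  by rewrite exprS; congr (_ *: _); ring.
by apply: gamma_positiveZ => //; apply: gamma_positive_elt; lia.
Qed.

(* The derivation x y (d/dx + d/dy) on forms of degree [m], restricted to
   [y = 1]. *)
Definition excD m f : {poly R} := 'X * (1 - 'X) * f^`() + m%:R * 'X * f.

Lemma excD0 m : excD m 0 = 0.
Proof. by rewrite /excD deriv0 !mulr0 addr0. Qed.

Lemma excDD m f g : excD m (f + g) = excD m f + excD m g.
Proof. by rewrite /excD derivD; ring. Qed.

Lemma excDZ m a f : excD m (a *: f) = a *: excD m f.
Proof. by rewrite /excD derivZ -!mul_polyC; ring. Qed.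

Lemma excD_sum m (I : finType) (F : I -> {poly R}) :
  excD m (\sum_i F i) = \sum_i excD m (F i).
Proof. exact: (big_morph _ (excDD m) (excD0 m)). Qed.

Lemma excD_widen m n f : excD (m + n) f = excD m f + n%:R * ('X * f).
Proof. by rewrite /excD natrD; ring. Qed.

Lemma mulX_derivXn k : 'X * ('X^k : {poly R})^`() = k%:R * 'X^k.
Proof.
case: k => [|k]; rewrite derivXn ?mulr0 ?mul0r // -mulr_natl exprS; ring.
Qed.

Lemma excD_Xn m k :
  excD m 'X^k = k%:R * 'X^k * (1 - 'X) + m%:R * 'X^(k.+1).
Proof.
rewrite /excD -mulrA mulrCA mulX_derivXn exprS; ring.
Qed.

(** This is the product rule for D v = u v and D u = 2 v at y = 1, where u = 1 + X and v = X. *)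
Lemma excD_elt k r :
  excD (2 * k + r) ('X^k * (1 + 'X) ^+ r) =
  k%:R *: ('X^k * (1 + 'X) ^+ r.+1)
  + (2 * r)%:R *: ('X^(k.+1) * (1 + 'X) ^+ r.-1).
Proof.
have d1X : ((1 + 'X) ^+ r : {poly R})^`() = r%:R * (1 + 'X) ^+ r.-1.
  by rewrite deriv_exp derivD derivX derivC add0r mul1r mulr_natl.
rewrite /excD derivM mulrDr -!mul_polyC !polyCMn !polyC1.
have -> : 'X * (1 - 'X) * (('X^k)^`() * (1 + 'X) ^+ r)
   = (1 - 'X) * ('X * ('X^k)^`()) * (1 + 'X) ^+ r :> {poly R} by ring.
rewrite mulX_derivXn d1X; case: r {d1X} => [|r] /=; rewrite ?exprS ?expr0; ring.
Qed.

Lemma gamma_positive_excD m f :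
  gamma_positive m f -> gamma_positive m.+1 (excD m.-1 f).
Proof.
apply: (gamma_positive_ind (P := fun g => gamma_positive m.+1 (excD m.-1 g)))
  => [|g h gP hP|a k a_ge0 k_lt].
- by rewrite excD0; apply: gamma_positive0.
- by rewrite excDD; apply: gamma_positiveD.
rewrite excDZ; apply: gamma_positiveZ => //.
rewrite /gamma_elt; set r := (m - 1 - 2 * k)%N.
have -> : m.-1 = (2 * k + r)%N by lia.
rewrite excD_elt; apply: gamma_positiveD.
  rewrite (_ : r.+1 = m.+1 - 1 - 2 * k)%N; last by lia.
  by apply: gamma_positiveZ; [exact: ler0n | apply: gamma_positive_elt; lia].
(* For r = 0 the element with exponent k + 1 lies outside the gamma basis, but its coefficient 2 r
   vanishes. *)
case: (posnP r) => [->|r_gt0].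
  by rewrite muln0 scale0r; apply: gamma_positive0.
rewrite (_ : r.-1 = m.+1 - 1 - 2 * k.+1)%N; last by lia.
by apply: gamma_positiveZ; [exact: ler0n | apply: gamma_positive_elt; lia].
Qed.

(** * Symmetric unimodal polynomials *)

(* Formal degree [m - 1], i.e. center of symmetry [(m - 1) / 2]. *)
Definition sym_unimodal m f : Prop :=
  [/\ forall i, (m <= i)%N -> f`_i = 0,
      forall i j, (i + j).+1 = m -> f`_i = f`_j,
      forall i j, (i <= j)%N -> (i + j < m)%N -> f`_i <= f`_j
    & forall i, 0 <= f`_i].

Lemma sym_unimodal_mul1X m f :
  sym_unimodal m f -> sym_unimodal m.+1 ((1 + 'X) * f).
Proof.
case=> f0 fsym fmono f_ge0.
have coef i : ((1 + 'X) * f)`_i = f`_i + if i is j.+1 then f`_j else 0.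
  by rewrite mulrDl mul1r coefD coefXM; case: i.
split.
- by case=> [|i] ?; rewrite coef !f0 ?addr0 //; lia.
- move=> [|i] [|j] ijm; rewrite !coef.
  + by [].
  + by rewrite addr0 (f0 j.+1) ?add0r; [apply: fsym | ]; lia.
  + by rewrite addr0 (f0 i.+1) ?add0r; [apply: fsym | ]; lia.
  + by rewrite addrC; congr (_ + _); apply: fsym; lia.
- move=> [|i] [|j] // ij ijm; rewrite !coef.
    by rewrite addr0 addrC (le_trans (fmono 0%N j _ _)) ?lerDl //; lia.
  (* The summands are compared crosswise, [i] with [j.+1] and [i.+1] with [j]: the pair [i.+1],
     [j.+1] could lie beyond the center. *)
  have [-> //|/eqP i_ne_j] := eqVneq i j.
  by rewrite addrC; apply: lerD; apply: fmono; lia.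
- by case=> [|i]; rewrite coef ?addr0 // addr_ge0.
Qed.

Lemma sym_unimodal_mulX m f : sym_unimodal m f -> sym_unimodal m.+2 ('X * f).
Proof.
case=> f0 fsym fmono f_ge0; split.
- by case=> [|i] ?; rewrite coefXM //=; apply: f0; lia.
- move=> [|i] [|j] ijm; rewrite !coefXM //=.
  + by rewrite f0 //; lia.
  + by rewrite f0 //; lia.
  + by apply: fsym; lia.
- by move=> [|i] [|j] ij ijm; rewrite !coefXM //=; apply: fmono; lia.
- by case=> [|i]; rewrite coefXM /=.
Qed.

Lemma sym_unimodal1 : sym_unimodal 1 1.
Proof.
split=> [[|i]|[|i] [|j]|[|i] [|j]|i] //; rewrite ?coef1 //; exact: ler0n.
Qed.

(** Each basis element arises from 1 by multiplications by 1 + X and by X, which preserve symmetry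
    and unimodality and move the center by 1/2 and 1. *)
Lemma gamma_positive_sym_unimodal m f : gamma_positive m f -> sym_unimodal m f.
Proof.
apply: gamma_positive_ind => [|g h [g0 gsym gmono g_ge0] [h0 hsym hmono h_ge0]|].
- by split=> *; rewrite !coef0.
- split=> [i ?|i j ?|i j ? ?|i]; rewrite !coefD.
  + by rewrite g0 ?h0 ?addr0.
  + by rewrite (gsym i j) ?(hsym i j).
  + by rewrite lerD ?gmono ?hmono.
  + by rewrite addr_ge0.
move=> a k a_ge0 k_lt.
suff [e0 esym emono e_ge0] : sym_unimodal m (gamma_elt m k).
  split=> [i ?|i j ?|i j ? ?|i]; rewrite !coefZ.
  + by rewrite e0 ?mulr0.
  + by rewrite (esym i j).
  + by rewrite ler_wpM2l ?emono.
  + by rewrite mulr_ge0.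
rewrite /gamma_elt; have [r r_eq] : exists r, r = (m - 1 - 2 * k)%N by eexists.
rewrite -r_eq; have -> : m = (r.+1 + 2 * k)%N by lia.
elim: k {k_lt r_eq} => [|k IHk].
  rewrite mul1r addn0; elim: r => [|r IHr]; first exact: sym_unimodal1.
  by rewrite exprS; apply: sym_unimodal_mul1X.
rewrite exprS -mulrA (_ : r.+1 + _ = (r.+1 + 2 * k).+2)%N; last by lia.
exact: sym_unimodal_mulX.
Qed.

(* Symmetry turns the index [m - 1 - i] into [i], whence the comparison for
   two indices whose mean lies to the right of the center. *)
Lemma sym_unimodal_le m f i j :
  sym_unimodal m f -> (j <= i)%N -> (m <= (i + j).+1)%N -> f`_i <= f`_j.
Proof.
case=> f0 fsym fmono f_ge0 ji mij.
case: (leqP m i) => [mi|im]; first by rewrite f0.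
by rewrite (fsym i (m.-1 - i)%N) ?fmono; lia.
Qed.

(** * Recovering the symmetric decomposition *)

(** Reversal in degree d fixes [f], and it sends ['X * g] to the reversal of [g] in degree d - 1,
    which is [g]. *)
Lemma reciprocal_symdec d f g :
  sym_unimodal d.+1 f -> sym_unimodal d g ->
  reciprocal d (f + 'X * g) = f + g.
Proof.
move=> [f0 fsym _ _] [g0 gsym _ _]; apply/polyP=> i.
rewrite coef_poly !coefD coefXM; case: ltnP => [i_lt|d_lt].
  rewrite (fsym (d - i)%N i); last by lia.
  by case: eqP => [di|di]; [rewrite (g0 i) //; lia | rewrite (gsym _ i) //; lia].
by rewrite f0 ?g0 ?addr0 //; lia.
Qed.

Lemma one_subX_neq0 : 1 - 'X != 0 :> {poly R}.
Proof. by rewrite -opprB oppr_eq0 -polyC1 polyXsubC_eq0. Qed.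

Lemma symdec_aE d f g : sym_unimodal d.+1 f -> sym_unimodal d g ->
  symdec_a d (f + 'X * g) = f.
Proof.
move=> fU gU; rewrite /symdec_a reciprocal_symdec //.
have -> : f + 'X * g - 'X * (f + g) = (1 - 'X) * f by ring.
by rewrite mulKp // one_subX_neq0.
Qed.

Lemma symdec_bE d f g : sym_unimodal d.+1 f -> sym_unimodal d g ->
  symdec_b d (f + 'X * g) = g.
Proof.
move=> fU gU; rewrite /symdec_b reciprocal_symdec //.
have -> : f + g - (f + 'X * g) = (1 - 'X) * g by ring.
by rewrite mulKp // one_subX_neq0.
Qed.

Lemma symdec_size d f g : sym_unimodal d.+1 f -> sym_unimodal d g ->
  (size (f + 'X * g)%R <= d.+1)%N.
Proof.
move=> [f0 _ _ _] [g0 _ _ _]; apply/leq_sizeP => i di.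
by rewrite coefD coefXM f0 // g0 ?if_same ?addr0 //; lia.
Qed.

(** The contributions of [f] agree by symmetry; those of ['X * g] reduce to g_(i-1) <= g_i, both
    indices being on the left of the center of [g]. *)
Lemma symdec_alternating d f g i : sym_unimodal d.+1 f -> sym_unimodal d g ->
  (2 * i < d)%N -> (f + 'X * g)`_i <= (f + 'X * g)`_(d - i).
Proof.
move=> [_ fsym _ _] [_ gsym gmono g_ge0] i_lt; rewrite !coefD !coefXM.
rewrite (fsym (d - i)%N i); last by lia.
rewrite lerD2l (_ : (d - i == 0)%N = false); last by lia.
rewrite (gsym (d - i).-1 i); last by lia.
by case: eqP => // ?; apply: gmono; lia.
Qed.
End Cones.

(** * Weights on fixed points and derangement polynomials *)

Section FixSum.
Variables (R : realType) (q : R).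
Implicit Types (g : nat -> R) (n k : nat).

(** An arbitrary weight [g] covers both the powers of p and the indicator of a given number of fixed
    points. *)
Definition fix_sum g n : {poly R} :=
  \sum_(s : 'S_n) (g (fix_pts s) * q ^+ cyc s) *: 'X^(exc s).

Lemma eq_fix_sum g g' n : g =1 g' -> fix_sum g n = fix_sum g' n.
Proof. by move=> gg'; apply: eq_bigr => s _; rewrite gg'. Qed.

Lemma fix_sumZ a g n : fix_sum (fun k => a * g k) n = a *: fix_sum g n.
Proof.
by rewrite scaler_sumr; apply: eq_bigr => s _; rewrite scalerA mulrA.
Qed.

(** The first term inserts a new fixed point. Insertion at an old fixed point lowers their number,
    whence [g k.-1]; [excD n] treats fixed points as letters y, and the last term removes that
    contribution. *)
Lemma fix_sum_rec g n :
  fix_sum g n.+1 =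
  q *: fix_sum (fun k => g k.+1) n + 'X * fix_sum (fun k => k%:R * g k.-1) n
  + excD n (fix_sum g n) - 'X * fix_sum (fun k => k%:R * g k) n.
Proof.
rewrite /fix_sum big_insert_max scaler_sumr !mulr_sumr excD_sum -!big_split.
rewrite -sumrB; apply: eq_bigr => s _ /=.
rewrite cyc_insert_fix exc_insert_fix fix_insert_fix.
set e := exc s; set f := fix_pts s; set Q : {poly R} := (q ^+ cyc s)%:P.
(* [T3] is the contribution of a non-fixed non-excedance; [T1] and [T2] are the corrections at an
   excedance and at a fixed point. *)
pose T1 : {poly R} := (g f)%:P * Q * 'X^e * (1 - 'X).
pose T2 : {poly R} := ((g f.-1)%:P - (g f)%:P) * Q * 'X^(e.+1).
pose T3 : {poly R} := (g f)%:P * Q * 'X^(e.+1).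
rewrite (eq_bigr (fun i : 'I_n => (i < s i)%:R * T1 + (s i == i)%:R * T2 + T3)).
  rewrite !big_split /= -!mulr_suml -!natr_sum -excE -fix_ptsE -/e -/f.
  rewrite sumr_const card_ord -mulr_natl excDZ excD_Xn -!mul_polyC.
  rewrite /T1 /T2 /T3 !exprS !polyCM !polyCMn !polyC1 -/Q.
  clear T1 T2 T3; clearbody e f Q; ring.
move=> i _; rewrite cyc_insert -mul_polyC polyCM -/Q.
have := exc_insert s i; have := fix_insert s i; rewrite -/e -/f /T1 /T2 /T3.
clear T1 T2 T3; clearbody e f Q.
case: eqVneq => [->|_]; rewrite ?ltnn ?addn0 ?addn1.
  by move=> <- /= ->; rewrite exprS; ring.
move=> ->; case: (i < s i)%N; rewrite ?addn1 ?addn0.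
  by case=> -> /=; rewrite exprS; ring.
by move=> -> /=; ring.
Qed.

Definition fix_part j n : {poly R} := fix_sum (fun k => (k == j)%:R) n.

Lemma fix_part_rec j n :
  fix_part j n.+1 =
  q *: fix_sum (fun k => (k.+1 == j)%:R) n + j.+1%:R *: ('X * fix_part j.+1 n)
  + excD n (fix_part j n) - j%:R *: ('X * fix_part j n).
Proof.
rewrite /fix_part fix_sum_rec !scalerAr -!fix_sumZ.
congr (_ + 'X * _ + _ - 'X * _); apply: eq_fix_sum.
  case=> [|k]; first by rewrite mul0r mulr0.
  by rewrite eqSS /=; case: eqP => [->|]; rewrite ?mulr1 ?mulr0.
by move=> k; case: eqP => [->|]; rewrite ?mulr1 ?mulr0.
Qed.

Lemma fix_sum_partition g n : fix_sum g n = \sum_(k < n.+1) g k *: fix_part k n.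
Proof.
rewrite /fix_part /fix_sum.
under [RHS]eq_bigr => k _ do rewrite scaler_sumr.
rewrite exchange_big; apply: eq_bigr => s _ /=.
have fix_le : (fix_pts s < n.+1)%N.
  by rewrite ltnS -[n in (_ <= n)%N]card_ord max_card.
rewrite (bigD1 (Ordinal fix_le)) //= eqxx mul1r scalerA.
rewrite big1 ?addr0 // => k; rewrite -val_eqE eq_sym => /negPf /= ->.
by rewrite mul0r scale0r scaler0.
Qed.

Definition derangement_poly n : {poly R} := fix_part 0 n.
Local Notation der := derangement_poly.

Lemma fix_sum0 g : fix_sum g 0 = g 0%N *: 1.
Proof.
have cyc0 (s : 'S_0) : cyc s = 0%N.
  apply/eqP; rewrite cards_eq0; apply/eqP/setP => A; rewrite inE.
  by apply/imsetP => -[[]].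
rewrite /fix_sum (eq_bigr (fun=> g 0%N *: 1)) => [|s _].
  by rewrite sumr_const card_Sn mulr1n.
by rewrite cyc0 fix_ptsE excE !big_ord0 mulr1.
Qed.

Lemma derangement_poly_rec0 n : der n.+1 = 'X * fix_part 1 n + excD n (der n).
Proof.
rewrite /der fix_part_rec scale1r scale0r subr0 (eq_fix_sum (g' := fun=> 0 * 0)).
  by rewrite fix_sumZ scale0r scaler0 add0r.
by move=> k; rewrite mul0r.
Qed.

(** Combinatorially, one chooses the [j] fixed points, each a cycle of weight q, and deranges the
    rest. The proof is instead by induction through the recurrence. *)
Lemma fix_part_derangement j n :
  fix_part j n = ('C(n, j)%:R * q ^+ j) *: der (n - j).
Proof.
have [k] := ubnP n; elim: k => // k IHk in n j *; rewrite ltnS => nk.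
case: j => [|j]; first by rewrite bin0 expr0 mulr1 scale1r subn0.
case: n nk => [|n] nk.
  by rewrite /fix_part fix_sum0 bin0n mul0r !scale0r.
rewrite fix_part_rec subSS binS natrD.
rewrite (eq_fix_sum (g' := fun k => (k == j)%:R)) // -/(fix_part j n) !IHk //.
case: (ltnP j n) => [jn|nj]; last first.
  rewrite (@bin_small n j.+1) ?(@bin_small n j.+2) //; last by lia.
  rewrite !mul0r !scale0r excD0 mulr0 !scaler0 !addr0 subr0 add0r.
  by rewrite exprS scalerA mulrCA.
have [m n_eq] : exists m, n = (m + j.+1)%N by exists (n - j.+1)%N; lia.
rewrite n_eq.
rewrite (_ : m + j.+1 - j = m.+1)%N; last by lia.
rewrite (_ : m + j.+1 - j.+1 = m)%N; last by lia.
(* The difference m - 1 truncates at m = 0, where the factor m in [binE] and [derE] removes the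
   term. *)
rewrite (_ : m + j.+1 - j.+2 = m - 1)%N; last by lia.
have binE : j.+2%:R * 'C(m + j.+1, j.+2)%:R = m%:R * 'C(m + j.+1, j.+1)%:R :> R.
  by rewrite -!natrM mul_bin_left addnK.
have derE : der m.+1 = (m%:R * q) *: ('X * der (m - 1)) + excD m (der m).
  by rewrite derangement_poly_rec0 IHk ?bin1 ?expr1 ?scalerAr //; lia.
rewrite -scalerAr [j.+2%:R *: _]scalerA mulrA binE excDZ excD_widen derE.
rewrite (exprS q j.+1) (exprS q j) -!mul_polyC !polyCM !polyCD !polyCMn !polyC1.
by ring.
Qed.

Lemma derangement_poly_rec n :
  der n.+1 = (n%:R * q) *: ('X * der (n - 1)) + excD n (der n).
Proof. by rewrite derangement_poly_rec0 fix_part_derangement bin1 scalerAr. Qed.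

Lemma gamma_positive_derangement n : 0 <= q -> gamma_positive n.+1 (der n).
Proof.
move=> q_ge0; have [k] := ubnP n; elim: k => // k IHk in n *; rewrite ltnS => nk.
case: n nk => [|n] nk.
  rewrite /der /fix_part fix_sum0 scale1r (_ : 1 = gamma_elt R 1 0).
    exact: gamma_positive_elt.
  by rewrite /gamma_elt expr0 mulr1.
rewrite derangement_poly_rec; apply: gamma_positiveD; last first.
  by apply: (@gamma_positive_excD R n.+1); apply: IHk.
case: n nk => [|n] nk; first by rewrite mul0r scale0r; apply: gamma_positive0.
apply: gamma_positiveZ; first by rewrite mulr_ge0 // ler0n.
by apply: gamma_positive_mulX; rewrite subn1; apply: IHk; lia.
Qed.

Lemma fix_sum_derangement g n :
  fix_sum g n =
  \sum_(k < n.+1) (g k * ('C(n, k)%:R * q ^+ k)) *: der (n - k).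
Proof.
rewrite fix_sum_partition; apply: eq_bigr => k _.
by rewrite fix_part_derangement scalerA.
Qed.

Lemma bi_gamma_fix_sum1 n : 0 <= q <= 1 -> exists a b : {poly R},
  [/\ gamma_positive n.+1 a, gamma_positive n b
    & fix_sum (fun=> 1) n.+1 = a + 'X * b].
Proof.
case/andP=> q_ge0 q_le1.
(* For constant weight the two terms counting old fixed points cancel. *)
have rec m : fix_sum (fun=> 1) m.+1
    = q *: fix_sum (fun=> 1) m + excD m (fix_sum (fun=> 1) m).
  by rewrite fix_sum_rec addrAC addrK.
elim: n => [|n [a [b [aG bG abE]]]].
  exists (q *: gamma_elt R 1 0), 0; split.
  - by apply: gamma_positiveZ => //; apply: gamma_positive_elt.
  - exact: gamma_positive0.
  rewrite rec fix_sum0 scale1r /excD derivC mulr0 !mul0r !addr0 mulr0 addr0.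
  by rewrite /gamma_elt expr0 mulr1.
(* Homogenizing with [y], the product rule on [y a + x y b] produces
   [q y^2 a], which [y^2 = y (x + y) - x y] splits again. *)
exists (q *: ((1 + 'X) * a) + excD n a + q *: ('X * b)),
  ((1 - q) *: a + (1 + 'X) * b + excD n.-1 b); split.
- apply: gamma_positiveD; last exact/gamma_positiveZ/gamma_positive_mulX.
  apply: gamma_positiveD; last exact: gamma_positive_excD aG.
  exact/gamma_positiveZ/gamma_positive_mul1X.
- apply: gamma_positiveD; last exact: gamma_positive_excD.
  apply: gamma_positiveD; last exact: gamma_positive_mul1X.
  by apply: gamma_positiveZ; rewrite ?subr_ge0.
(* The degree n - 1 of [b] truncates at n = 0, where [b] is zero. *)
rewrite rec abE; case: n {abE aG} bG => [/gamma_positive_size0-> | n _].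
  by rewrite /excD !derivE -!mul_polyC polyCB polyC1; ring.
rewrite /excD derivD derivM derivX -!mul_polyC polyCB polyC1 /=.
by rewrite -!natr1; ring.
Qed.

End FixSum.

(** * Coefficients of A_n as functions of p *)

Lemma ApolyE (R : realType) n (p q : R) :
  Apoly n p q = fix_sum q (fun k => p ^+ k) n.
Proof. by []. Qed.

Lemma Apoly1E (R : realType) n (q : R) : Apoly n 1 q = fix_sum q (fun=> 1) n.
Proof. by rewrite ApolyE; apply: eq_fix_sum => k; rewrite expr1n. Qed.

Lemma coef_Apoly (R : realType) n (p q : R) i :
  (Apoly n p q)`_i =
  \sum_(k < n.+1)
    p ^+ k * ('C(n, k)%:R * q ^+ k * (derangement_poly q (n - k))`_i).
Proof.
rewrite ApolyE fix_sum_derangement coef_sum; apply: eq_bigr => k _.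
by rewrite coefZ -[LHS]mulrA.
Qed.

Section Coefficients.
Variables (R : realType) (n : nat) (p q : R).
Hypotheses (hp : 0 <= p <= 1) (q_ge0 : 0 <= q).
Local Notation T k i := ('C(n, k)%:R * q ^+ k * (derangement_poly q (n - k))`_i).

Let p_ge0 : 0 <= p. Proof. by case/andP: hp. Qed.
Let p_le1 k : p ^+ k <= 1. Proof. by case/andP: hp => *; apply: exprn_ile1. Qed.

Let binq_ge0 k : 0 <= 'C(n, k)%:R * q ^+ k.
Proof. by rewrite mulr_ge0 ?ler0n ?exprn_ge0. Qed.

Let der_unimodal k : sym_unimodal (n - k).+1 (derangement_poly q (n - k)).
Proof. exact/gamma_positive_sym_unimodal/gamma_positive_derangement. Qed.

Let T_le k i j :
  (j <= i)%N -> ((n - k).+1 <= (i + j).+1)%N -> T k i <= T k j.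
Proof. by move=> ji nij; apply/ler_wpM2l/(sym_unimodal_le (der_unimodal k)). Qed.

(** All summands in [coef_Apoly] are nonnegative and p^k <= 1. This carries the degree bound from p
    = 1 to every p. *)
Lemma coef_Apoly_le1 i : 0 <= (Apoly n p q)`_i <= (Apoly n 1 q)`_i.
Proof.
rewrite !coef_Apoly; have T_ge0 k : 0 <= T k i.
  by case: (der_unimodal k) => _ _ _ der_ge0; rewrite mulr_ge0.
rewrite sumr_ge0 => [|k _]; last by rewrite mulr_ge0 ?exprn_ge0.
by apply: ler_sum => k _; rewrite expr1n ler_wpM2r.
Qed.

(** Every summand has center (n-k)/2 <= n/2 <= (i+j)/2, so all of them compare in the same
    direction. *)
Lemma coef_Apoly_le_left i j : (j <= i)%N -> (n <= i + j)%N ->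
  (Apoly n p q)`_i <= (Apoly n p q)`_j.
Proof.
move=> ji nij; rewrite !coef_Apoly; apply: ler_sum => k _.
by rewrite ler_wpM2l ?exprn_ge0 // T_le //; lia.
Qed.

(* Only the term [k = 0] of [coef_Apoly], which is independent of [p], can
   make the difference positive, so the difference is smallest at [p = 1]. *)
Lemma coef_Apoly_le_right i j : (j <= i)%N -> (n <= (i + j).+1)%N ->
  (Apoly n 1 q)`_j <= (Apoly n 1 q)`_i -> (Apoly n p q)`_j <= (Apoly n p q)`_i.
Proof.
move=> ji nij; rewrite -subr_ge0 => le1; rewrite -subr_ge0.
apply: le_trans le1 _.
rewrite !coef_Apoly -!sumrB; apply: ler_sum => k _.
rewrite -!mulrBr expr1n mul1r; case: (posnP k) => [->|k_gt0].
  by rewrite expr0 mul1r.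
rewrite -[leLHS]mul1r; apply: ler_wnM2r => //.
by rewrite mulrBr subr_le0 T_le //; lia.
Qed.
End Coefficients.

(** * Bi-gamma-positivity and the alternating chain *)

Theorem theorem10 (R : realType) (p q : R)
    (hp : 0 <= p <= 1) (hq : 0 <= q <= 1) :
  (forall n : nat, (1 <= n)%N ->
     bi_gamma_positive n.-1 (Apoly n 1 q) /\
     exists xi eta : nat -> R,
       [/\ forall k, 0 <= xi k,
           forall k, 0 <= eta k
         & Apoly n 1 q =
             \sum_(0 <= k < ((n - 1) %/ 2).+1)
                xi k *: ('X^k * (1 + 'X) ^+ (n - 1 - 2 * k))
             (* floor((n-2)/2) + 1 = floor(n/2); the sum is empty if n = 1 *)
             + 'X * \sum_(0 <= k < n %/ 2)
                eta k *: ('X^k * (1 + 'X) ^+ (n - 2 - 2 * k))])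
  /\
  (forall n : nat, (1 <= n)%N ->
     alternatingly_increasing n.-1 (Apoly n p q)).
Proof.
have q_ge0 : 0 <= q by case/andP: hq.
split=> -[//|n] _ /=; have [a [b [aG bG abE]]] := bi_gamma_fix_sum1 n hq;
  have aU := gamma_positive_sym_unimodal aG;
  have bU := gamma_positive_sym_unimodal bG.
  rewrite Apoly1E abE; split.
    by split; rewrite ?symdec_size ?symdec_aE ?symdec_bE.
  case: aG bG => [xi [xi_ge0 ->]] [eta [eta_ge0 ->]]; exists xi, eta; split=> //.
  rewrite /gamma_sum (_ : uphalf n.+1 = ((n.+1 - 1) %/ 2).+1); last first.
    by rewrite divn2 subn1.
  by rewrite (_ : uphalf n = n.+1 %/ 2)%N // divn2.
have coef1 i : (Apoly n.+1 1 q)`_i = (a + 'X * b)`_i by rewrite Apoly1E abE.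
split=> [|j j_lt].
  apply/leq_sizeP => i ni; apply/eqP; rewrite eq_le.
  have /andP[-> /le_trans-> //] := coef_Apoly_le1 n.+1 hp q_ge0 i.
  by rewrite coef1 (leq_sizeP _ _ (symdec_size aU bU)).
have j_eq : j = (odd j + 2 * j./2)%N by rewrite mul2n odd_double_half.
(* With l = [j./2], odd [j] asks for f_(n-l) <= f_(l+1), which holds summand by summand; even [j]
   asks for f_l <= f_(n-l), which is transferred from the decomposition at p = 1. *)
rewrite /alt_index oddS /= uphalf_half; case: ifP j_eq => j_odd j_eq /=.
  by apply: coef_Apoly_le_left => //; lia.
apply: coef_Apoly_le_right => //; try lia.
by rewrite !coef1 symdec_alternating //; lia.
Qed.
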